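(* Let $A\in\mathbb{R}^{n\times n}$ be a stable matrix with $n$ distinct eigenvalues $\lambda_1,\dots,\lambda_n$. The Lyapunov energies of states associated with particular modes (and the unnormalized Lyapunov participation factors) can be calculated through the corresponding eigenvalues and eigenvectors. Namely, for all $k,i,j\in\{1,\dots,n\}$: (i) under the conventional initial condition $x_0=e_k$, $$E_{x_ki}=E_{x_k}e_{ki}=-\left\{(u_i^k)^*(v_i^k)^*\,e_k^T(\lambda_i^*I+A)^{-1}e_k\right\}_H,$$ $$E_{x_kij}=E_{x_k}\tilde e_{k(ij)}=-\frac12\left\{\frac{(v_i^k)^*(u_i^k)^*u_j^kv_j^k}{\lambda_i^*+\lambda_j}+\frac{v_i^ku_i^ku_j^kv_j^k}{\lambda_i+\lambda_j}\right\}_H;$$ (ii) under spherically symmetric initial conditions, i.e. $x_0$ random with $\mathrm{E}\{x_k^0x_{k'}^0\}=\delta_{kk'}$, $$E_{x_ki}=E_{x_k}e_{ki}=-\mathrm{Re}\left\{\mathrm{trace}\left((v_i^T)^*(u_i^k)^*e_k^T(\lambda_i^*I+A)^{-1}\right)\right\},$$ $$E_{x_kij}=E_{x_k}\tilde e_{k(ij)}=-\frac12\,\mathrm{trace}\left\{\frac{(v_i^T)^*(u_i^k)^*u_j^kv_j^T}{\lambda_i^*+\lambda_j}+\frac{v_iu_i^ku_j^kv_j^T}{\lambda_i+\lambda_j}\right\}_H.$$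
   Context: $(\cdot)^*$ denotes the conjugate transpose of a matrix or vector (complex conjugate of a scalar), $(\cdot)^T$ the transpose, and $\{M\}_H=\frac12(M+M^* )$ (for a scalar, its real part). Stable means all eigenvalues have negative real part. $e_k$ (single index) is the $k$-th column of the identity matrix, while $e_{ki}$ (two indices) is a participation factor. Eigenvectors: $A=U\Lambda V$, $\Lambda=\mathrm{diag}(\lambda_1,\dots,\lambda_n)$, $U=(u_1\cdots u_n)$, $V=U^{-1}$ with rows $v_1^T,\dots,v_n^T$; $u_i^k$, $v_i^k$ are the $k$-th components of $u_i$, $v_i$. Eigenvectors of real eigenvalues are real, eigenvectors of complex conjugate eigenvalues are entrywise complex conjugates of each other, and $|u_i|^2=1$. The residue matrices are $R_i=u_iv_i^T$, i.e. $(sI-A)^{-1}=\sum_iR_i/(s-\lambda_i)$. For the system $\dot x=Ax$, $x(0)=x_0$, $P_{x_k}$ is the solution of $A^*P_{x_k}+P_{x_k}A=-e_ke_k^T$, with sub-Gramians $$\widetilde P_{x_ki}=-\left\{R_i^*e_ke_k^T(\lambda_i^*I+A)^{-1}\right\}_H,\qquad P_{x_kij}=-\frac12\left\{\frac{R_i^*e_ke_k^TR_j}{\lambda_i^*+\lambda_j}+\frac{R_i^Te_ke_k^TR_j}{\lambda_i+\lambda_j}\right\}_H.$$ For a deterministic initial state $x_0$, the Lyapunov energy of the $k$-th state is $E_{x_k}=x_0^TP_{x_k}x_0=\int_0^\infty x_k^2(t)\,dt$, its part associated with mode $i$ is $E_{x_ki}=x_0^T\widetilde P_{x_ki}x_0$,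 and its part associated with the pair of modes $i,j$ is $E_{x_kij}=x_0^TP_{x_kij}x_0$. For random $x_0$ with $\mathrm{E}\{x_k^0x_{k'}^0\}=\delta_{kk'}$, the symbols $E_{x_k}$, $E_{x_ki}$, $E_{x_kij}$ denote the expectations of these quadratic forms, i.e. $\mathrm{trace}(P_{x_k})$, $\mathrm{trace}(\widetilde P_{x_ki})$, $\mathrm{trace}(P_{x_kij})$. In both cases the mode-in-state Lyapunov participation factor and its pair version are $e_{ki}=E_{x_ki}/E_{x_k}$ and $\tilde e_{k(ij)}=E_{x_kij}/E_{x_k}$. *)

(* Defs.v *)
(* MathComp-Analysis, with complex numbers R[i] over R : realType *)
From mathcomp Require Import all_boot all_order all_algebra.
From mathcomp Require Import complex.
From mathcomp Require Import all_classical all_reals all_analysis.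

Set Implicit Arguments.
Unset Strict Implicit.
Unset Printing Implicit Defensive.

Import Order.TTheory GRing.Theory Num.Theory.
Local Open Scope classical_set_scope.
Local Open Scope ring_scope.

Notation "M ^ct" := (map_mx Num.conj M^T)
  (at level 8, format "M ^ct") : ring_scope.

Section Modal.
Variables (R : realType) (n : nat).
Local Notation C := R[i].

Definition toC (m p : nat) (M : 'M[R]_(m, p)) : 'M[C]_(m, p) :=
  map_mx (real_complex R) M.

Definition herm (m : nat) (M : 'M[C]_m) : 'M[C]_m := 2^-1 *: (M + M^ct).

Definition ecol (S : pzSemiRingType) (k : 'I_n) : 'cV[S]_n := delta_mx k 0.

Definition stable (A : 'M[R]_n) : Prop :=
  forall z : C, eigenvalue (toC A) z -> 'Re z < 0.

(* The columns of U are the right eigenvectors u_i, the rows of V are the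
   left eigenvectors v_i^T; so u_i^k is U k i and v_i^k is V i k. *)
Record modal_decomposition (A : 'M[R]_n) (lam : 'I_n -> C) (U V : 'M[C]_n)
    : Prop := ModalDecomposition {
  modal_unit : U \in unitmx;
  modal_inv : V = invmx U;
  modal_eq : toC A = U *m diag_mx (\row_i lam i) *m V;
  modal_real : forall i, lam i \is Num.real ->
    forall k, U k i \is Num.real;
  modal_conj : forall i j, lam j = (lam i)^* ->
    forall k, U k j = (U k i)^*;
  modal_norm : forall i, \sum_k `|U k i| ^+ 2 = 1
}.

Definition residue (U V : 'M[C]_n) (i : 'I_n) : 'M[C]_n :=
  col i U *m row i V.

(* Junk value 0 if the Lyapunov equation has no solution; for stable A the
   solution exists and is unique. *)
Definition stateGramian (A : 'M[R]_n) (k : 'I_n) : 'M[C]_n :=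
  xget 0 [set P : 'M[C]_n | (toC A)^ct *m P + P *m toC A
                            = - (ecol C k *m (ecol C k)^T)].

Definition modeGramian (A : 'M[R]_n) (lam : 'I_n -> C) (U V : 'M[C]_n)
    (k i : 'I_n) : 'M[C]_n :=
  - herm ((residue U V i)^ct *m ecol C k *m (ecol C k)^T
          *m invmx (((lam i)^*)%:M + toC A)).

Definition pairGramian (lam : 'I_n -> C) (U V : 'M[C]_n) (k i j : 'I_n)
    : 'M[C]_n :=
  - (2^-1 *: herm (
    ((lam i)^* + lam j)^-1 *:
      ((residue U V i)^ct *m ecol C k *m (ecol C k)^T *m residue U V j)
    + (lam i + lam j)^-1 *:
      ((residue U V i)^T *m ecol C k *m (ecol C k)^T *m residue U V j))).

Definition quadForm (x0 : 'cV[R]_n) (P : 'M[C]_n) : C :=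
  ((toC x0)^T *m P *m toC x0) 0 0.

(* fine sends infinite expectations to 0; this is harmless below, where the
   quadratic forms are integrable as soon as x_0 has finite second moments. *)
Definition Cexpectation (d : measure_display) (T : measurableType d)
    (Pr : probability T R) (Z : T -> C) : C :=
  Complex (fine ('E_Pr[fun w => complex.Re (Z w)])%E)
          (fine ('E_Pr[fun w => complex.Im (Z w)])%E).

Definition meanQuadForm (d : measure_display) (T : measurableType d)
    (Pr : probability T R) (X : 'I_n -> {RV Pr >-> R}) (P : 'M[C]_n) : C :=
  Cexpectation Pr (fun w => quadForm (\col_k X k w) P).

Definition spherically_symmetric (d : measure_display) (T : measurableType d)
    (Pr : probability T R) (X : 'I_n -> {RV Pr >-> R}) : Prop :=
  forall k l : 'I_n, ('E_Pr[fun w => (X k w * X l w)%R] = ((k == l)%:R)%:E)%E.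

(* Below Q assigns to a (sub-)Gramian the value of its quadratic form for the
   initial condition at hand: quadForm x0 when x0 is deterministic,
   meanQuadForm X when it is the random vector X. *)
Definition stateEnergy (Q : 'M[C]_n -> C) (A : 'M[R]_n) (k : 'I_n) : C :=
  Q (stateGramian A k).

Definition modeEnergy (Q : 'M[C]_n -> C) (A : 'M[R]_n) (lam : 'I_n -> C)
    (U V : 'M[C]_n) (k i : 'I_n) : C :=
  Q (modeGramian A lam U V k i).

Definition pairEnergy (Q : 'M[C]_n -> C) (lam : 'I_n -> C)
    (U V : 'M[C]_n) (k i j : 'I_n) : C :=
  Q (pairGramian lam U V k i j).

Definition participation (Q : 'M[C]_n -> C) (A : 'M[R]_n) (lam : 'I_n -> C)
    (U V : 'M[C]_n) (k i : 'I_n) : C :=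
  modeEnergy Q A lam U V k i / stateEnergy Q A k.

Definition pairParticipation (Q : 'M[C]_n -> C) (A : 'M[R]_n)
    (lam : 'I_n -> C) (U V : 'M[C]_n) (k i j : 'I_n) : C :=
  pairEnergy Q lam U V k i j / stateEnergy Q A k.

End Modal.

Arguments ecol {n} S k.

(* Main.v *)
Require Import Defs.
From mathcomp Require Import all_boot all_order all_algebra.
From mathcomp Require Import complex ring.
From mathcomp Require Import all_classical all_reals all_analysis.
From mathcomp Require Import measurable_realfun.

Set Implicit Arguments.
Unset Strict Implicit.
Unset Printing Implicit Defensive.

Import Order.TTheory GRing.Theory Num.Theory.
Local Open Scope ring_scope.

(** Write every sub-Gramian as [- herm M] or [- (1/2) herm M].  The energies
are values of a functional [Q] on Gramians: [Q P = P k k] when [x_0 = e_k], and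
[Q P = \tr P] when the components of [x_0] are orthonormal in mean square, by
linearity of the expectation ([meanQuadForm_trace]).  Both functionals turn
[herm] into a real part, and a residue [u_i v_i^T] has rank one, so that
[e_k] only extracts the component [u_i^k] from it.  This gives the formulas
for the energies.

What needs an argument is that the energy of the state, by which participation
factors are normalized, does not vanish.  For [x_0 = e_k] it is the integral of
[x_k(t)^2], where [x_k(t)] is the sum of [u_j^k v_j^k exp(lambda_j t)]; it is
positive as [x_k(0) = 1].  Integrated term by term, it is the Hermitian form
with the Cauchy matrix [1 / (a_i^* + a_j)], [a_i = - lambda_i], at the vector
with components [u_j^k v_j^k].  For random [x_0] the energy is the trace of the
Gramian, whose diagonal entries are Cauchy forms as well, and the [k]-th one is
the positive number just described.  Instead of exponentials, the proof uses this
closed form: the Lyapunov equation is diagonal in modal coordinates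
([lyapunov_modal]), which yields existence and uniqueness of the Gramian and
the Cauchy form of its diagonal entries ([stateGramian_diag]).  A Cauchy matrix
with distinct nodes in the right half-plane is positive definite
([cauchyForm_ge0_eq0]), because eliminating one node leaves a Cauchy form in
the other nodes ([cauchyForm_schur]). *)

(** * Positive definiteness of Cauchy matrices *)

Section CauchyForm.
Variables (C : numClosedFieldType) (I : eqType) (a : I -> C).
Hypothesis a_gt0 : forall i, 0 < (a i)^* + a i.

Definition cauchyForm (s : seq I) (c : I -> C) : C :=
  \sum_(i <- s) \sum_(j <- s) (c i)^* * c j / ((a i)^* + a j).

Lemma cauchy_denom_neq0 i j : (a i)^* + a j != 0.
Proof.
apply/eqP => aij; have eqj : a j = - (a i)^* by apply/eqP; rewrite -addr_eq0 addrC aij.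
have := a_gt0 j; rewrite eqj rmorphN /= conjCK -opprD oppr_gt0 => /lt_trans.
by move=> /(_ _ (a_gt0 i)); rewrite addrC ltxx.
Qed.

(** Schur complement with respect to the node [a x]: up to the factors absorbed
in the new coefficients, the entry [1 / (a_i^* + a_j)] minus the rank-one part
[(a_x^* + a_x) / ((a_i^* + a_x) (a_x^* + a_j))] is again the Cauchy entry.  The
new coefficient at [x] is zero, which eliminates that node. *)
Lemma cauchyForm_schur (s : seq I) (c : I -> C) (x : I) :
  cauchyForm s c =
    ((a x)^* + a x) * `|\sum_(j <- s) c j / ((a x)^* + a j)| ^+ 2
    + cauchyForm s (fun j => c j * (a j - a x) / ((a x)^* + a j)).
Proof.
rewrite normCK mulrC -mulrA mulrC -mulrA rmorph_sum /= [X in X + _]mulr_suml.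
rewrite -big_split /=; apply: eq_bigr => i _.
rewrite mulr_sumr mulr_sumr -big_split /=; apply: eq_bigr => j _.
rewrite !(rmorphM, rmorphB, rmorphD, fmorphV) /= conjCK.
have := cauchy_denom_neq0 i j; have := cauchy_denom_neq0 x j.
have := cauchy_denom_neq0 i x => dix dxj dij.
field.
by rewrite dij dxj addrC dix.
Qed.

Hypothesis a_inj : injective a.

(** Induction on the nodes, by elimination of the first one.  When the form
vanishes, distinctness of the nodes transfers the vanishing of the new
coefficients to the old ones at the remaining nodes; the square in
[cauchyForm_schur] then gives the coefficient at the eliminated node. *)
Lemma cauchyForm_ge0_eq0 (s : seq I) (c : I -> C) : uniq s ->
  0 <= cauchyForm s c
  /\ (cauchyForm s c = 0 -> forall i, i \in s -> c i = 0).
Proof.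
elim: s c => [c _|x s IHs c /= /andP[xs us]].
  by rewrite /cauchyForm big_nil.
rewrite (cauchyForm_schur (x :: s) c x); set c' := fun j => c j * (a j - a x) / ((a x)^* + a j).
have c'x : c' x = 0 by rewrite /c' subrr mulr0 mul0r.
have -> : cauchyForm (x :: s) c' = cauchyForm s c'.
  rewrite /cauchyForm big_cons big1 ?add0r => [|j _]; last first.
    by rewrite c'x rmorph0 !mul0r.
  by apply: eq_bigr => i _; rewrite big_cons c'x mulr0 mul0r add0r.
have [q_ge0 q_eq0] := IHs c' us.
have t_ge0 : 0 <= ((a x)^* + a x)
    * `|\sum_(j <- x :: s) c j / ((a x)^* + a j)| ^+ 2.
  by rewrite mulr_ge0 ?exprn_ge0 // ltW.
split; first exact: addr_ge0.
move/eqP; rewrite paddr_eq0 // => /andP[t0 /eqP/q_eq0 c'0].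
have cs i : i \in s -> c i = 0.
  move=> si; move: (c'0 i si) => /eqP; rewrite /c' mulf_eq0 mulf_eq0 invr_eq0.
  rewrite (negPf (cauchy_denom_neq0 x i)) orbF subr_eq0 => /orP[/eqP //|].
  by move=> /eqP/a_inj ix; rewrite -ix si in xs.
move=> i; rewrite inE => /predU1P[->|]; last exact: cs.
move: t0; rewrite mulf_eq0 (negPf (cauchy_denom_neq0 x x)) /=.
rewrite sqrf_eq0 normr_eq0 big_cons big_seq big1 => [|j sj]; last first.
  by rewrite cs // mul0r.
by rewrite addr0 mulf_eq0 invr_eq0 (negPf (cauchy_denom_neq0 x x)) orbF => /eqP.
Qed.

End CauchyForm.

(** * The Gramian of a state in modal coordinates *)

Section Gramian.
Variables (R : realType) (n : nat) (A : 'M[R]_n).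
Variables (lam : 'I_n -> R[i]) (U V : 'M[R[i]]_n).
Hypothesis hstable : stable A.
Hypothesis hmodal : modal_decomposition A lam U V.

Let UV : U *m V = 1%:M.
Proof. by rewrite (modal_inv hmodal) mulmxV // (modal_unit hmodal). Qed.

Let VU : V *m U = 1%:M.
Proof. exact: mulmx1C UV. Qed.

Let ct_inverse (M N : 'M[R[i]]_n) : M *m N = 1%:M -> N^ct *m M^ct = 1%:M.
Proof. by move=> MN; rewrite -map_mxM -trmx_mul MN trmx1 map_mx1. Qed.

Let AU : toC A *m U = U *m diag_mx (\row_i lam i).
Proof. by rewrite (modal_eq hmodal) -mulmxA VU mulmx1. Qed.

(** Stability puts the nodes [- lambda_i] in the open right half-plane, as
the rows of [V] are left eigenvectors. *)
Lemma mode_decay i : 0 < (- lam i)^* + - lam i.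
Proof.
have ev : eigenvalue (toC A) (lam i).
  apply/eigenvalueP; exists (row i V).
    rewrite (modal_eq hmodal) !mulmxA -row_mul VU -row_mul mul1mx -row_mul.
    by rewrite mul_diag_mx; apply/rowP => j; rewrite !mxE.
  apply/eqP => /(congr1 (mulmx^~ U)); rewrite -row_mul VU mul0mx.
  by move=> /rowP/(_ i) /eqP; rewrite !mxE eqxx oner_eq0.
have := hstable ev; rewrite ReE pmulr_llt0 ?invr_gt0 ?ltr0n //.
by rewrite rmorphN /= -opprD oppr_gt0 addrC.
Qed.

(** Congruence by [U] makes the Lyapunov operator diagonal: on the entry
[(i, j)] it is multiplication by [lambda_i^* + lambda_j], which is nonzero. *)
Lemma lyapunov_modal k (P : 'M[R[i]]_n) :
  (toC A)^ct *m P + P *m toC A = - (ecol R[i] k *m (ecol R[i] k)^T)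
  <-> forall i j, (U^ct *m P *m U) i j
        = (U k i)^* * U k j / ((- lam i)^* + - lam j).
Proof.
have inj : injective (fun M : 'M[R[i]]_n => U^ct *m M *m U).
  apply: (can_inj (g := fun M => V^ct *m M *m V)) => M.
  rewrite !mulmxA ct_inverse // mul1mx.
  by rewrite -mulmxA UV mulmx1.
pose Dct := diag_mx (\row_i (lam i)^*).
have UA : U^ct *m (toC A)^ct = Dct *m U^ct.
  rewrite -map_mxM -trmx_mul AU trmx_mul map_mxM tr_diag_mx map_diag_mx.
  by congr (diag_mx _ *m _); apply/rowP => i; rewrite !mxE.
have lhsE : U^ct *m ((toC A)^ct *m P + P *m toC A) *m U
    = Dct *m (U^ct *m P *m U) + (U^ct *m P *m U) *m diag_mx (\row_i lam i).
  by rewrite mulmxDr mulmxDl !mulmxA UA -!mulmxA AU.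
have rhsE : U^ct *m - (ecol R[i] k *m (ecol R[i] k)^T) *m U
    = - (col k U^ct *m row k U).
  rewrite mulmxN mulNmx !mulmxA -colE trmx_delta.
  by rewrite -(mulmxA (col _ _)) -rowE.
have entryE i j :
    (Dct *m (U^ct *m P *m U) + (U^ct *m P *m U) *m diag_mx (\row_i lam i)) i j
    = - ((U^ct *m P *m U) i j * ((- lam i)^* + - lam j)).
  rewrite mul_diag_mx mul_mx_diag; move: (U^ct *m P *m U) => Q.
  by rewrite !mxE rmorphN /=; ring.
have wE i j : (- (col k U^ct *m row k U)) i j = - ((U k i)^* * U k j).
  by rewrite !mxE big_ord1 !mxE.
split=> [eqP' i j|eqQ].
  apply: (mulIf (cauchy_denom_neq0 mode_decay i j)).
  rewrite divfK ?(cauchy_denom_neq0 mode_decay i j) //; apply: oppr_inj.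
  by rewrite -entryE -wE -lhsE eqP' rhsE.
apply: inj; rewrite /= lhsE rhsE; apply/matrixP => i j; rewrite entryE wE eqQ.
by rewrite divfK ?(cauchy_denom_neq0 mode_decay i j).
Qed.

Lemma stateGramian_solves k :
  (toC A)^ct *m stateGramian A k + stateGramian A k *m toC A
  = - (ecol R[i] k *m (ecol R[i] k)^T).
Proof.
suff solved : exists P : 'M[R[i]]_n, (toC A)^ct *m P + P *m toC A
    = - (ecol R[i] k *m (ecol R[i] k)^T) by exact: (xgetPex 0 solved).
pose Q : 'M[R[i]]_n :=
  \matrix_(i, j) ((U k i)^* * U k j / ((- lam i)^* + - lam j)).
exists (V^ct *m Q *m V); apply/lyapunov_modal => i j.
rewrite !mulmxA ct_inverse // mul1mx -mulmxA VU mulmx1.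
by rewrite mxE.
Qed.

(** The entry [(m, m)] is the time integral of [x_k(t)^2] for [x_0 = e_m], and
there [x_k(t)] is the sum of [u_j^k v_j^m exp(lambda_j t)]. *)
Lemma stateGramian_diag k m :
  stateGramian A k m m =
  cauchyForm (fun i => - lam i) (index_enum 'I_n) (fun j => U k j * V j m).
Proof.
have /lyapunov_modal eqQ := stateGramian_solves k.
have -> : stateGramian A k = V^ct *m (U^ct *m stateGramian A k *m U) *m V.
  rewrite !mulmxA ct_inverse // mul1mx.
  by rewrite -mulmxA UV mulmx1.
rewrite mxE /cauchyForm exchange_big /=; apply: eq_bigr => j _.
rewrite mxE mulr_suml; apply: eq_bigr => i _.
by rewrite eqQ !mxE rmorphM /=; ring.
Qed.

Hypothesis hdistinct : injective lam.

Lemma stateGramian_diag_ge0 k m : 0 <= stateGramian A k m m.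
Proof.
rewrite stateGramian_diag.
have inj : injective (fun i => - lam i) by move=> i j /oppr_inj/hdistinct.
by have [] := cauchyForm_ge0_eq0 mode_decay inj (fun j => U k j * V j m)
  (index_enum_uniq 'I_n).
Qed.

(** The coefficients [u_j^k v_j^k] of the Cauchy form add up to
[(U V) k k = 1], so they are not all zero. *)
Lemma stateGramian_diag_neq0 k : stateGramian A k k k != 0.
Proof.
rewrite stateGramian_diag; apply/eqP.
have inj : injective (fun i => - lam i) by move=> i j /oppr_inj/hdistinct.
have [_ /[apply] c0] := cauchyForm_ge0_eq0 mode_decay inj
  (fun j => U k j * V j k) (index_enum_uniq 'I_n).
have : (U *m V) k k = 1 by rewrite UV mxE eqxx.
rewrite mxE big1 => [/eqP|j _]; first by rewrite eq_sym oner_eq0.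
by rewrite c0 ?mem_index_enum.
Qed.

Lemma stateGramian_trace_neq0 k : \tr (stateGramian A k) != 0.
Proof.
rewrite /mxtrace psumr_eq0 => [|m _]; last exact: stateGramian_diag_ge0.
by apply/allPn; exists k; rewrite ?mem_index_enum ?stateGramian_diag_neq0.
Qed.

End Gramian.

(** * Quadratic forms of the initial state *)

Section Herm.
Variables (R : realType) (n : nat).
Local Notation C := R[i].

Lemma herm_diag (M : 'M[C]_n) k : herm M k k = 'Re (M k k).
Proof. by rewrite /herm !mxE ReE mulrC. Qed.

Lemma trace_herm (M : 'M[C]_n) : \tr (herm M) = 'Re (\tr M).
Proof.
rewrite /mxtrace raddf_sum; apply: eq_bigr => k _; exact: herm_diag.
Qed.

Lemma quadForm_ecol (k : 'I_n) (P : 'M[C]_n) : quadForm (ecol R k) P = P k k.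
Proof.
have -> : quadForm (ecol R k) P = ((ecol C k)^T *m P *m ecol C k) 0 0.
  by rewrite /quadForm /toC /ecol map_delta_mx.
by rewrite /ecol trmx_delta -rowE -colE !mxE.
Qed.

End Herm.

Section Spherical.
Variables (R : realType) (n : nat) (d : measure_display) (T : measurableType d).
Variables (Pr : probability T R) (X : 'I_n -> {RV Pr >-> R}).
Hypothesis hX : spherically_symmetric X.

(** By [|x y| <= x^2 + y^2]: the second moments [E{x_k^2} = 1] are finite. *)
Lemma integrable_moment k l :
  Pr.-integrable [set: T]%classic (fun w => (X k w * X l w)%:E).
Proof.
have mX j h : measurable_fun setT (fun w : T => X j w * X h w).
  exact: measurable_funM.
have sq j : Pr.-integrable [set: T]%classic (fun w => (X j w * X j w)%:E).
  apply/integrableP; split; first exact/measurable_EFinP.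
  have := hX j j; rewrite eqxx unlock => jE.
  under eq_integral => w _ do
    rewrite gee0_abs ?lee_fin -?expr2 ?sqr_ge0 // expr2.
  by rewrite jE ltry.
apply: (@le_integrable _ _ _ _ _ measurableT _
  (fun w => (X k w * X k w)%:E + (X l w * X l w)%:E)%E).
- exact/measurable_EFinP.
- move=> w _; rewrite -EFinD /= lee_fin.
  rewrite [leRHS]ger0_norm ?addr_ge0 -?expr2 ?sqr_ge0 //.
  rewrite normrM -(real_normK (num_real (X k w))) -(real_normK (num_real (X l w))).
  set x := `|X k w|; set y := `|X l w|.
  have x0 : 0 <= x := normr_ge0 _. have y0 : 0 <= y := normr_ge0 _.
  rewrite -subr_ge0; have -> : x ^+ 2 + y ^+ 2 - x * y = (x - y) ^+ 2 + x * y by ring.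
  by rewrite addr_ge0 ?sqr_ge0 // mulr_ge0.
- exact: integrableD.
Qed.

Lemma expectation_bilinear (a : 'I_n -> 'I_n -> R) :
  ('E_Pr[fun w => (\sum_k \sum_l a k l * (X k w * X l w))%R]
   = (\sum_k a k k)%R%:E)%E.
Proof.
rewrite unlock.
under eq_integral => w _ do rewrite pair_big /= -sumEFin.
rewrite integral_sum //; last first.
  move=> p; have := integrable_moment p.1 p.2.
  by move=> /(integrableZl measurableT (a p.1 p.2)).
under eq_bigr => p _.
  under eq_integral => w _ do rewrite EFinM.
  rewrite integralZl //; last exact: integrable_moment.
  have := hX p.1 p.2; rewrite unlock => ->.
  rewrite -EFinM.
  over.
rewrite sumEFin; congr EFin.
rewrite -(pair_bigA _ (fun k l => a k l * (k == l)%:R)) /=.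
apply: eq_bigr => k _; rewrite (bigD1 k) //= eqxx mulr1 big1 ?addr0 // => l.
by rewrite eq_sym => /negPf ->; rewrite mulr0.
Qed.

Lemma meanQuadForm_trace (P : 'M[R[i]]_n) : meanQuadForm X P = \tr P.
Proof.
have qE w : quadForm (\col_k X k w) P
    = \sum_k \sum_l P k l * (real_complex R (X k w * X l w)).
  rewrite /quadForm mxE exchange_big /=; apply: eq_bigr => l _.
  rewrite mxE mulr_suml; apply: eq_bigr => k _.
  by rewrite !mxE rmorphM /=; ring.
have ReM (z : R[i]) (x : R) : complex.Re (z * real_complex R x) = complex.Re z * x.
  by case: z => u v /=; rewrite mulr0 subr0.
have ImM (z : R[i]) (x : R) : complex.Im (z * real_complex R x) = complex.Im z * x.
  by case: z => u v /=; rewrite mulr0 add0r.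
rewrite /meanQuadForm /Cexpectation.
have -> : (fun w => complex.Re (quadForm (\col_k X k w) P))
    = (fun w => \sum_k \sum_l complex.Re (P k l) * (X k w * X l w)).
  apply/funext => w; rewrite qE !raddf_sum /=; apply: eq_bigr => k _.
  by rewrite raddf_sum /=; apply: eq_bigr => l _; rewrite ReM.
have -> : (fun w => complex.Im (quadForm (\col_k X k w) P))
    = (fun w => \sum_k \sum_l complex.Im (P k l) * (X k w * X l w)).
  apply/funext => w; rewrite qE !raddf_sum /=; apply: eq_bigr => k _.
  by rewrite raddf_sum /=; apply: eq_bigr => l _; rewrite ImM.
rewrite !expectation_bilinear /= /mxtrace.
by rewrite -!raddf_sum /=; case: (\sum_k _).
Qed.

End Spherical.

(** * Sub-Gramians through eigenvectors *)

Section RankOneSum.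
Variables (S : comPzRingType) (n : nat) (a b x x' : S) (w w' : 'cV[S]_n).

(** The two terms differ by conjugations only.  Over an abstract ring they are
syntactically distinct, so that rewriting does not attempt to identify them by
unfolding complex arithmetic. *)
Lemma rank_one_sum (y : S) (e v : 'rV[S]_n) (M : 'M[S]_n) : e *m M = y *: v ->
  a *: (x *: w *m e *m M) + b *: (x' *: w' *m e *m M)
  = a *: ((x * y) *: (w *m v)) + b *: ((x' * y) *: (w' *m v)).
Proof.
by move=> eM; rewrite -!(mulmxA _ e) eM -!scalemxAl -!scalemxAr !(scalerA _ y).
Qed.

Lemma rank_one_sum_entry (v : 'rV[S]_n) k l :
  (a *: (x *: (w *m v)) + b *: (x' *: (w' *m v))) k l
  = a * (x * (w k 0 * v 0 l)) + b * (x' * (w' k 0 * v 0 l)).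
Proof. by rewrite !mxE !big_ord1. Qed.

End RankOneSum.

Section SubGramians.
Variables (R : realType) (n : nat) (U V : 'M[R[i]]_n).

Lemma ecol_residue k j : (ecol R[i] k)^T *m residue U V j = U k j *: row j V.
Proof.
rewrite /residue mulmxA trmx_delta -rowE.
by apply/rowP => l; rewrite !mxE big_ord1 !mxE.
Qed.

Lemma residue_tr_ecol k i :
  (residue U V i)^T *m ecol R[i] k = U k i *: (row i V)^T.
Proof. by rewrite -[LHS]trmxK trmx_mul trmxK ecol_residue linearZ. Qed.

Lemma residue_ct_ecol k i :
  (residue U V i)^ct *m ecol R[i] k = (U k i)^* *: (row i V)^ct.
Proof.
have -> : ecol R[i] k = map_mx Num.conj (ecol R[i] k).
  by rewrite /ecol map_delta_mx.
by rewrite -map_mxM residue_tr_ecol map_mxZ.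
Qed.

Lemma modeGramian_eigenvectors (A : 'M[R]_n) lam k i :
  modeGramian A lam U V k i =
  - herm ((U k i)^* *: ((row i V)^ct *m (ecol R[i] k)^T
                          *m invmx (((lam i)^*)%:M + toC A))).
Proof. by rewrite /modeGramian residue_ct_ecol !scalemxAl. Qed.

Lemma pairGramian_eigenvectors lam k i j :
  pairGramian lam U V k i j =
  - (2^-1 *: herm (
      ((lam i)^* + lam j)^-1 *:
        (((U k i)^* * U k j) *: ((row i V)^ct *m row j V))
      + (lam i + lam j)^-1 *:
        ((U k i * U k j) *: ((row i V)^T *m row j V)))).
Proof.
rewrite /pairGramian residue_ct_ecol residue_tr_ecol.
by rewrite (rank_one_sum _ _ _ _ _ _ (ecol_residue k j)).
Qed.

End SubGramians.

Theorem mainTheorem5 (R : realType) (n : nat) (A : 'M[R]_n)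
    (lam : 'I_n -> R[i]) (U V : 'M[R[i]]_n)
    (hstable : stable A)
    (hdistinct : injective lam)
    (hmodal : modal_decomposition A lam U V) :
  (* (i) x_0 = e_k *)
  (forall k i j : 'I_n,
    let Q := quadForm (ecol R k) in
    [/\ modeEnergy Q A lam U V k i
          = stateEnergy Q A k * participation Q A lam U V k i,
        modeEnergy Q A lam U V k i
          = - 'Re ((U k i)^* * (V i k)^* *
                   ((ecol R[i] k)^T *m invmx (((lam i)^*)%:M + toC A)
                      *m ecol R[i] k) 0 0),
        pairEnergy Q lam U V k i j
          = stateEnergy Q A k * pairParticipation Q A lam U V k i j
      & pairEnergy Q lam U V k i j
          = - (2^-1 *
               'Re ((V i k)^* * (U k i)^* * U k j * V j k
                      / ((lam i)^* + lam j)
                    + V i k * U k i * U k j * V j k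
                      / (lam i + lam j)))])
  /\
  (* (ii) x_0 random with E{x_k x_l} = delta_kl *)
  (forall (d : measure_display) (T : measurableType d) (Pr : probability T R)
      (X : 'I_n -> {RV Pr >-> R}),
    spherically_symmetric X ->
    forall k i j : 'I_n,
    let Q := meanQuadForm X in
    [/\ modeEnergy Q A lam U V k i
          = stateEnergy Q A k * participation Q A lam U V k i,
        modeEnergy Q A lam U V k i
          = - 'Re (\tr ((U k i)^* *: ((row i V)^ct *m (ecol R[i] k)^T
                          *m invmx (((lam i)^*)%:M + toC A)))),
        pairEnergy Q lam U V k i j
          = stateEnergy Q A k * pairParticipation Q A lam U V k i j
      & pairEnergy Q lam U V k i j
          = - (2^-1 * \tr (herm (
               ((lam i)^* + lam j)^-1 *:
                 (((U k i)^* * U k j) *: ((row i V)^ct *m row j V))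
               + (lam i + lam j)^-1 *:
                 ((U k i * U k j) *: ((row i V)^T *m row j V)))))]).
Proof.
split=> [k i j Q|d T Pr X hX k i j Q].
- have nz : stateEnergy Q A k != 0.
    rewrite /stateEnergy /Q quadForm_ecol.
    exact: stateGramian_diag_neq0 hstable hmodal hdistinct k.
  have cancel x : x = stateEnergy Q A k * (x / stateEnergy Q A k).
    by rewrite mulrC divfK.
  split; [exact: cancel| |exact: cancel|].
    rewrite /modeEnergy /Q quadForm_ecol modeGramian_eigenvectors.
    rewrite mxE herm_diag -colE -mulmxA; congr (- 'Re _).
    by rewrite mxE [X in _ * X]mxE big_ord1 !mxE mulrA.
  rewrite /pairEnergy /Q quadForm_ecol pairGramian_eigenvectors.
  rewrite mxE [X in - X]mxE herm_diag; congr (- (_ * 'Re _)).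
  by rewrite rank_one_sum_entry !mxE; ring.
- have nz : stateEnergy Q A k != 0.
    rewrite /stateEnergy /Q meanQuadForm_trace //.
    exact: stateGramian_trace_neq0 hstable hmodal hdistinct k.
  have cancel x : x = stateEnergy Q A k * (x / stateEnergy Q A k).
    by rewrite mulrC divfK.
  split; [exact: cancel| |exact: cancel|].
    rewrite /modeEnergy /Q meanQuadForm_trace // modeGramian_eigenvectors.
    by rewrite raddfN /= trace_herm.
  rewrite /pairEnergy /Q meanQuadForm_trace // pairGramian_eigenvectors.
  by rewrite raddfN /= mxtraceZ.
Qed.
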